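(* Let $A$ be an artin algebra. Assume that every simple $A$-module $S$ is a submodule of a finitely generated $A$-module $M_S$ of finite projective dimension. Let $d=\max_S \operatorname{pd} M_S$, where $S$ runs through the simple modules. Then $$\operatorname{Fin-inj} A\ \le\ \operatorname{del} A\ \le\ d\ \le\ \operatorname{fin-pro} A .$$
   Context: Modules are left $A$-modules; $\operatorname{pd} M$ and $\operatorname{id} M$ denote projective and injective dimension. $\operatorname{fin-pro} A$ is the supremum of $\operatorname{pd} M$ over finitely generated modules $M$ with $\operatorname{pd} M<\infty$. $\operatorname{Fin-inj} A$ is the supremum of $\operatorname{id} N$ over all (not necessarily finitely generated) modules $N$ with $\operatorname{id} N<\infty$. For a finitely generated module $M$, $\Omega M$ is the kernel of a projective cover of $M$, $\Omega^0M=M$ and $\Omega^{d+1}M=\Omega(\Omega^dM)$. The delooping level $\operatorname{del} M$ is the smallest $d\ge 0$ such that $\Omega^d M$ is a direct summand of $P\oplus\Omega^{d+1}M'$ for some finitely generated modules $P, M'$ with $P$ projective ($\operatorname{del}M=\infty$ if no such $d$ exists). $\operatorname{del} A=\max_S\operatorname{del} S$, where $S$ runs through the simple modules. *)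

(* Defs.v *)
From mathcomp Require Import all_boot all_order all_algebra.
From mathcomp Require Import boolp classical_sets constructive_ereal.

Set Implicit Arguments.
Unset Strict Implicit.
Unset Printing Implicit Defensive.
Import Order.TTheory GRing.Theory Num.Theory.
Local Open Scope classical_set_scope.
Local Open Scope ring_scope.

(* Homological dimensions are natural numbers or infinity. They are taken in
   [\bar int], the smallest library type that has these values together with
   the order used by [supremum] and [infimum]. *)
Definition sup_dim (X : set (\bar int)) : \bar int := supremum -oo%E X.

Definition least_dim (P : set nat) : \bar int :=
  infimum +oo%E [set (n%:Z)%:E | n in P].

Section Modules.
Variable A : nzRingType.
Implicit Types M N P S U V W X Y : lmodType A.

Definition is_submodule M (N : set M) : Prop :=
  N 0 /\ forall (a : A) (x y : M), N x -> N y -> N (a *: x + y).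

Definition finitely_generated M : Prop :=
  exists (n : nat) (g : 'I_n -> M),
    forall x, exists c : 'I_n -> A, x = \sum_(i < n) c i *: g i.

Definition artinian_module M : Prop :=
  forall I : nat -> set M,
    (forall n, is_submodule (I n)) ->
    (forall n, I n.+1 `<=` I n) ->
    exists n, forall m, (n <= m)%N -> I m = I n.

Definition simple_module S : Prop :=
  (exists x : S, x != 0) /\
  forall N : set S, is_submodule N -> N = [set 0] \/ N = [set: S].

Definition embeds_in U V : Prop := exists f : {linear U -> V}, injective f.

Definition isomorphic U V : Prop := exists f : {linear U -> V}, bijective f.

Definition direct_summand X Y : Prop :=
  exists Z : lmodType A, isomorphic (X * Z)%type Y.

Definition projective P : Prop :=
  forall U V (g : {linear U -> V}) (f : {linear P -> V}),
    range g = [set: V] -> exists h : {linear P -> U}, forall x, g (h x) = f x.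

Definition injective_module (I : lmodType A) : Prop :=
  forall U V (g : {linear U -> V}) (f : {linear U -> I}),
    injective g -> exists h : {linear V -> I}, forall x, h (g x) = f x.

Definition kernel U V (f : {linear U -> V}) : set U := [set x | f x = 0].

Definition exact U V W (f : {linear U -> V}) (g : {linear V -> W}) : Prop :=
  range f = kernel g.

(* 0 -> P_n -> ... -> P_0 -> M -> 0, padded with zero modules in degrees > n *)
Definition has_projective_resolution M (n : nat) : Prop :=
  exists (P : nat -> lmodType A) (d : forall i, {linear P i.+1 -> P i})
         (e : {linear P 0%N -> M}),
    [/\ forall i, projective (P i),
        forall i, (n < i)%N -> forall x : P i, x = 0,
        range e = [set: M],
        exact (d 0%N) e &
        forall i, exact (d i.+1) (d i)].

(* 0 -> M -> I_0 -> ... -> I_n -> 0, padded with zero modules in degrees > n *)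
Definition has_injective_resolution M (n : nat) : Prop :=
  exists (I : nat -> lmodType A) (d : forall i, {linear I i -> I i.+1})
         (e : {linear M -> I 0%N}),
    [/\ forall i, injective_module (I i),
        forall i, (n < i)%N -> forall x : I i, x = 0,
        injective e,
        exact e (d 0%N) &
        forall i, exact (d i) (d i.+1)].

Definition pd M : \bar int := least_dim (has_projective_resolution M).

Definition id_dim M : \bar int := least_dim (has_injective_resolution M).

Definition projective_cover P M (f : {linear P -> M}) : Prop :=
  [/\ projective P,
      range f = [set: M] &
      forall N : set P, is_submodule N ->
        (forall x, exists y z, [/\ N y, kernel f z & x = y + z]) ->
        N = [set: P]].

(* Syzygies are determined up to isomorphism only, hence the relations:
   [is_syzygy M K] says that K is a copy of Omega M, and [is_nsyzygy d M K]
   that K is a copy of Omega^d M. *)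
Definition is_syzygy M (K : lmodType A) : Prop :=
  exists P (f : {linear P -> M}) (i : {linear K -> P}),
    [/\ projective_cover f, injective i & exact i f].

Fixpoint is_nsyzygy (d : nat) M (K : lmodType A) : Prop :=
  match d with
  | 0%N => isomorphic K M
  | d'.+1 => exists L : lmodType A, is_nsyzygy d' M L /\ is_syzygy L K
  end.

Definition deloops_at M (d : nat) : Prop :=
  exists (K P M' L : lmodType A),
    [/\ is_nsyzygy d M K,
        finitely_generated P /\ projective P,
        finitely_generated M',
        is_nsyzygy d.+1 M' L &
        direct_summand K (P * L)%type].

Definition del M : \bar int := least_dim (deloops_at M).

End Modules.

Definition artin_algebra (k : comNzRingType) (A : algType k) : Prop :=
  artinian_module (k^o : lmodType k) /\ finitely_generated (A : lmodType k).

Definition fin_pro (A : nzRingType) : \bar int :=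
  sup_dim [set x | exists M : lmodType A,
    [/\ finitely_generated M, (pd M < +oo)%E & x = pd M]].

Definition Fin_inj (A : nzRingType) : \bar int :=
  sup_dim [set x | exists N : lmodType A, (id_dim N < +oo)%E /\ x = id_dim N].

(* The supremum over all simple modules is the maximum over representatives of
   the isomorphism classes whenever f is isomorphism invariant: an artin
   algebra has finitely many simple modules up to isomorphism. *)
Definition max_simple (A : nzRingType) (f : lmodType A -> \bar int) : \bar int :=
  sup_dim [set x | exists S : lmodType A, simple_module S /\ x = f S].

Definition del_ring (A : nzRingType) : \bar int := max_simple (@del A).

(* Main.v *)
Require Import Defs.
From HB Require Import structures.
From mathcomp Require Import all_boot all_order all_algebra.
From mathcomp Require Import boolp classical_sets constructive_ereal.

(** The theorem is three independent inequalities; only the first two have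
    content, since each [pd (M S)] is one of the values whose supremum is
    [fin_pro A].

    For [del_ring A <= d], take [S] inside [M] with [pd M = n] and put
    [Z = M / S]. The horseshoe lemma turns [0 -> S -> M -> Z -> 0] into a short
    exact sequence of first syzygies whose middle term has projective dimension
    at most [n - 1]. After [n] such steps the middle term [P] is projective, so
    the sequence [0 -> Omega^n S -> P -> Omega^n Z -> 0] is a projective
    presentation of [Omega^n Z], and Schanuel's lemma makes [Omega^n S] a direct
    summand of [P + Omega^(n+1) Z] ([syzygy_of_sub_summand]). Hence
    [del S <= pd M] for each simple [S] separately.

    For [Fin_inj A <= del_ring A], suppose that [N] has an injective resolution
    of length [n + 1] and that every simple [S] deloops at some [m <= n]. As
    [Omega^m S] is a summand of [P + Omega^(m+1) M'], dimension shifting makes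
    [Ext^(n+1) (S, N)] a direct summand of [Ext^(n+2) (M', N) = 0]
    ([ext_vanishes_deloop]). So [Ext^1 (S, C) = 0] for the [n]-th cosyzygy [C] of
    [N] and every simple [S]; over an artin algebra this forces [C] to be
    injective ([injective_of_simple_lifts]), and the resolution can be shortened
    to length [n]. So the minimal length of a resolution is at most [del_ring A].

    What the artin algebra contributes is finiteness: finitely generated modules
    satisfy the descending chain condition, because they are finitely generated
    over the artinian base ring; their submodules are again finitely generated
    ([finitely_generated_submodule]); consequently nonzero modules have simple
    submodules ([exists_simple_submodule]) and finitely generated modules have
    projective covers ([exists_projective_cover]), hence syzygies of all orders.

    Subobjects and quotients are handled as sets of elements and turned into
    modules only up to isomorphism, as the source of an injective linear map or
    the target of a surjective one. *)

Set Implicit Arguments.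
Unset Strict Implicit.
Unset Printing Implicit Defensive.
Import Order.TTheory GRing.Theory Num.Theory.
Local Open Scope classical_set_scope.
Local Open Scope ring_scope.

(** * Linear maps, submodules and quotients *)

Section LinearMaps.
Variable A : nzRingType.
Implicit Types X Y Z U V W P Q : lmodType A.

Lemma linear_map_of X Y (f : X -> Y) :
  linear f -> exists g : {linear X -> Y}, g =1 f.
Proof.
move=> lf; pose m := GRing.isLinear.Build A X Y *:%R f lf.
by pose g : {linear X -> Y} := HB.pack f m; exists g.
Qed.

Lemma submodule0 X (N : set X) : is_submodule N -> N 0.
Proof. by case. Qed.

Lemma submoduleZ X (N : set X) a x : is_submodule N -> N x -> N (a *: x).
Proof. by case=> N0 /(_ a x 0) + Nx => /(_ Nx N0); rewrite addr0. Qed.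

Lemma submoduleD X (N : set X) x y : is_submodule N -> N x -> N y -> N (x + y).
Proof. by case=> N0 /(_ 1 x y) + Nx Ny => /(_ Nx Ny); rewrite scale1r. Qed.

Lemma submoduleB X (N : set X) x y : is_submodule N -> N x -> N y -> N (x - y).
Proof.
move=> hN Nx Ny; rewrite -scaleN1r; apply: submoduleD => //.
exact: submoduleZ.
Qed.

Lemma range_submodule X Y (f : {linear X -> Y}) : is_submodule (range f).
Proof.
split; first by exists 0; rewrite ?linear0.
by move=> a _ _ [x _ <-] [y _ <-]; exists (a *: x + y); rewrite ?linearP.
Qed.

Lemma preimage_submodule X Y (f : {linear X -> Y}) (N : set Y) :
  is_submodule N -> is_submodule (f @^-1` N).
Proof.
case=> N0 hN; split; first by rewrite /preimage /= linear0.
by move=> a x y Nx Ny; rewrite /preimage /= linearP; apply: hN.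
Qed.

Lemma image_submodule X Y (f : {linear X -> Y}) (N : set X) :
  is_submodule N -> is_submodule (f @` N).
Proof.
case=> N0 hN; split; first by exists 0; rewrite ?linear0.
move=> a _ _ [x Nx <-] [y Ny <-]; exists (a *: x + y); rewrite ?linearP //.
exact: hN.
Qed.

Lemma kernel_submodule X Y (f : {linear X -> Y}) : is_submodule (kernel f).
Proof.
split; first by rewrite /kernel /= linear0.
by move=> a x y; rewrite /kernel /= linearP => -> ->; rewrite scaler0 addr0.
Qed.

Lemma setI_submodule X (M N : set X) :
  is_submodule M -> is_submodule N -> is_submodule (M `&` N).
Proof.
move=> [M0 hM] [N0 hN]; split=> // a x y [Mx Nx] [My Ny].
by split; [apply: hM | apply: hN].
Qed.

Lemma setT_submodule X : is_submodule [set: X].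
Proof. by split. Qed.

Lemma set0_submodule X : is_submodule [set 0 : X].
Proof. by split=> // a x y -> ->; rewrite scaler0 addr0. Qed.

Lemma injectiveP0 X Y (f : {linear X -> Y}) :
  (forall x, f x = 0 -> x = 0) -> injective f.
Proof.
move=> f0 x y fxy; apply/eqP; rewrite -subr_eq0; apply/eqP/f0.
by rewrite linearB fxy subrr.
Qed.

Lemma surjP X Y (f : X -> Y) : range f = [set: Y] <-> forall y, exists x, f x = y.
Proof.
split=> [fT y|fs]; last by apply/seteqP; split=> // y _; have [x <-] := fs y; exists x.
have : range f y by rewrite fT.
by case=> x _ <-; exists x.
Qed.

Lemma exactP U V W (f : {linear U -> V}) (g : {linear V -> W}) :
  exact f g <-> (forall x, g (f x) = 0) /\ (forall y, g y = 0 -> exists x, f x = y).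
Proof.
split=> [fg|[gf0 fg]].
  split=> [x|y gy]; first by have : kernel g (f x) by rewrite -fg; exists x.
  have : range f y by rewrite fg.
  by case=> x _ <-; exists x.
apply/seteqP; split=> [_ [x _ <-]|y /fg[x <-]]; [exact: gf0 | by exists x].
Qed.

Section Submodule.
Variables (X : lmodType A) (N : set X) (hN : is_submodule N).

(** The proof argument lets instance inference find the closure properties of
    the boolean predicate. *)
Definition submodule_pred of is_submodule N : {pred X} := fun x => `[< N x >].

Lemma submodule_predP : submod_closed (submodule_pred hN).
Proof.
case: hN => N0 N_; split=> [|a x y /asboolP Nx /asboolP Ny]; first exact/asboolP.
by apply/asboolP/N_.
Qed.

HB.instance Definition _ :=
  GRing.isSubmodClosed.Build A X (submodule_pred hN) submodule_predP.

Record submodule_type :=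
  SubmoduleElt { submodule_val :> X; _ : submodule_val \in submodule_pred hN }.
HB.instance Definition _ := [isSub for submodule_val].
HB.instance Definition _ := [Choice of submodule_type by <:].
HB.instance Definition _ := [SubChoice_isSubLmodule of submodule_type by <:].

Definition quotient_type := Quotient.quot (submodule_pred hN).
HB.instance Definition _ := GRing.Zmodule.on quotient_type.

Definition quotient_class (x : X) : quotient_type :=
  (\pi_(Quotient.quot (submodule_pred hN)) x)%qT.

Lemma quotient_classE x y : quotient_class x = quotient_class y <-> N (x - y).
Proof.
split; first by move/eqP; rewrite -Quotient.idealrBE => /asboolP.
by move=> Nxy; apply/eqP; rewrite -Quotient.idealrBE; apply/asboolP.
Qed.

Lemma quotient_class_surj v : {x | v = quotient_class x}.
Proof. by exists (repr v); rewrite /quotient_class reprK. Qed.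

Lemma quotient_class0 : quotient_class 0 = 0.
Proof. exact: raddf0. Qed.

Lemma quotient_classD : {morph quotient_class : x y / x + y}.
Proof. by move=> x y; exact: raddfD. Qed.

Definition quotient_scale (a : A) (v : quotient_type) : quotient_type :=
  quotient_class (a *: sval (quotient_class_surj v)).

Lemma quotient_scaleE a x : quotient_scale a (quotient_class x) = quotient_class (a *: x).
Proof.
apply/quotient_classE; rewrite -scalerBr; apply: submoduleZ => //.
by apply/quotient_classE; case: quotient_class_surj.
Qed.

Lemma quotient_scale_axioms :
  [/\ forall a b v, quotient_scale a (quotient_scale b v) = quotient_scale (a * b) v,
      left_id 1 quotient_scale, right_distributive quotient_scale +%R
    & forall v, {morph quotient_scale^~ v : a b / a + b}].
Proof.
split=> [a b v|v|a u v|v a b]; have [x ->] := quotient_class_surj v.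
- by rewrite !quotient_scaleE scalerA.
- by rewrite quotient_scaleE scale1r.
- have [y ->] := quotient_class_surj u.
  by rewrite -quotient_classD !quotient_scaleE scalerDr quotient_classD.
- by rewrite !quotient_scaleE scalerDl quotient_classD.
Qed.

Let quotient_scaleA a b v := let: And4 h _ _ _ := quotient_scale_axioms in h a b v.
Let quotient_scale1 := let: And4 _ h _ _ := quotient_scale_axioms in h.
Let quotient_scaleDr := let: And4 _ _ h _ := quotient_scale_axioms in h.
Let quotient_scaleDl := let: And4 _ _ _ h := quotient_scale_axioms in h.

HB.instance Definition _ := GRing.Zmodule_isLmodule.Build A quotient_type
  quotient_scaleA quotient_scale1 quotient_scaleDr quotient_scaleDl.

Lemma submodule_as_module :
  exists (U : lmodType A) (i : {linear U -> X}), injective i /\ range i = N.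
Proof.
exists submodule_type, (val : {linear submodule_type -> X}); split; first exact: val_inj.
apply/seteqP; split=> [_ [x _ <-]|x Nx]; first by have /asboolP := valP x.
have Nx' : x \in submodule_pred hN by apply/asboolP.
by exists (Sub x Nx').
Qed.

Lemma quotient_module :
  exists (Q : lmodType A) (p : {linear X -> Q}), range p = [set: Q] /\ kernel p = N.
Proof.
have lp : linear quotient_class.
  by move=> a x y; rewrite quotient_classD -quotient_scaleE.
have [p pE] := linear_map_of lp.
exists quotient_type, p; split.
  by apply/surjP => v; have [x ->] := quotient_class_surj v; exists x; rewrite pE.
apply/seteqP; split=> x; rewrite /kernel /= pE -quotient_class0.
  by move/quotient_classE; rewrite subr0.
by move=> Nx; apply/quotient_classE; rewrite subr0.
Qed.

End Submodule.

Lemma factor_through_surj X Y Q (p : {linear X -> Q}) (f : {linear X -> Y}) :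
  range p = [set: Q] -> (forall x, p x = 0 -> f x = 0) ->
  exists u : {linear Q -> Y}, forall x, u (p x) = f x.
Proof.
move=> /surjP/choice[s ps] pf.
have fs x : f (s (p x)) = f x.
  by apply/eqP; rewrite -subr_eq0 -linearB pf // linearB ps subrr.
have lu : linear (f \o s).
  by move=> a x y /=; rewrite -linearP -[RHS]fs linearP !ps.
by have [u uE] := linear_map_of lu; exists u => x; rewrite uE /= fs.
Qed.

Lemma factor_through_inj X Y U (i : {linear U -> X}) (f : {linear Y -> X}) :
  injective i -> (forall y, exists x, i x = f y) ->
  exists g : {linear Y -> U}, forall y, i (g y) = f y.
Proof.
move=> i_inj /choice[s is_].
have ls : linear s by move=> a x y; apply: i_inj; rewrite linearP !is_ linearP.
by have [g gE] := linear_map_of ls; exists g => y; rewrite gE.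
Qed.

End LinearMaps.

(** * Chain conditions *)

Section Chains.
Variable A : nzRingType.
Implicit Types X Y Z U V W P Q : lmodType A.

(** Zorn's lemma in the one form used here. The set [E] of forbidden elements
    covers two situations: a submodule missing a given element, and the graph of
    a partial linear map, which is a submodule of a product without elements
    [(0, c)], [c <> 0]. *)
Lemma maximal_submodule_avoiding X (B E : set X) :
  is_submodule B -> (forall x, B x -> ~ E x) ->
  exists N, [/\ is_submodule N, B `<=` N, (forall x, N x -> ~ E x) &
    forall N', is_submodule N' -> N `<=` N' -> (forall x, N' x -> ~ E x) ->
      N' `<=` N].
Proof.
move=> hB BE.
(* Chains may be empty, so it is [B `|` N], not [N], that has to be a submodule. *)
pose P (N : set X) := is_submodule (B `|` N) /\ (forall x, (B `|` N) x -> ~ E x).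
have P0 : P set0 by split; rewrite setU0.
have [F FP totF|N [[hN NE] Nmax]] := @Zorn_bigcup X P.
  have pick x y : (B `|` \bigcup_(M in F) M) x -> (B `|` \bigcup_(M in F) M) y ->
      exists M, [/\ P M, M `<=` \bigcup_(M in F) M, (B `|` M) x & (B `|` M) y].
    case=> [Bx|[M FM Mx]] [By|[M' FM' My]].
    - by exists set0; split=> //; left.
    - exists M'; split; [exact: FP|exact: bigcup_sup|by left|by right].
    - exists M; split; [exact: FP|exact: bigcup_sup|by right|by left].
    - have [MM'|M'M] := totF _ _ FM FM'.
        exists M'; split; [exact: FP|exact: bigcup_sup|right; exact: MM'|by right].
      exists M; split; [exact: FP|exact: bigcup_sup|by right|right; exact: M'M].
  split; last by move=> x Fx; have [M [[_ ME] _ Mx _]] := pick x x Fx Fx; exact: ME.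
  split; first by left; exact: submodule0.
  move=> a x y Fx Fy; have [M [[[_ hM] _] MF Mx My]] := pick x y Fx Fy.
  by have [|Mxy] := hM a _ _ Mx My; [left | right; exact: MF].
exists (B `|` N); split=> // N' hN' NN' N'E.
have eN' : B `|` N' = N' by apply/setUidPr => x Bx; apply: NN'; left.
have NN'2 : N `<=` N' by move=> x Nx; apply: NN'; right.
have [N'N|N'N] := pselect (N' `<=` N); first by move=> x /N'N; right.
by case: (Nmax N'); [split | rewrite /P eN'].
Qed.

(** The condition is relative to a set so that it applies to submodules and to
    generated submodules without passing to subtypes. *)
Definition dcc_on X (N : set X) : Prop :=
  forall I : nat -> set X,
    (forall n, is_submodule (I n)) -> (forall n, I n `<=` N) ->
    (forall n, I n.+1 `<=` I n) ->
    exists n, forall m, (n <= m)%N -> I m = I n.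

Lemma decreasing_le X (I : nat -> set X) :
  (forall n, I n.+1 `<=` I n) -> forall m n, (m <= n)%N -> I n `<=` I m.
Proof.
move=> dI m n /subnK <-; elim: (n - m)%N => // j IH x /dI; exact: IH.
Qed.

Lemma dcc_minimal X (N : set X) (F : set (set X)) M0 :
  dcc_on N -> (forall M, F M -> is_submodule M /\ M `<=` N) -> F M0 ->
  exists M, F M /\ forall M', F M' -> M' `<=` M -> M' = M.
Proof.
move=> dN FN FM0; apply: contrapT => noM.
have /choice[next nextP] (M : set X) :
    exists M', F M -> [/\ F M', M' `<=` M & M' <> M].
  have [FM|] := pselect (F M); last by exists M.
  apply: contrapT => noM'; apply: noM; exists M; split=> // M' FM' M'M.
  by apply: contrapT => neM; apply: noM'; exists M'.
pose I n := iter n next M0.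
have FI n : F (I n) by elim: n => //= n /nextP[].
have [||n|n /(_ n.+1 (leqnSn n))] := dN I.
- by move=> n; case: (FN _ (FI n)).
- by move=> n; case: (FN _ (FI n)).
- by case: (nextP _ (FI n)).
- by case: (nextP _ (FI n)).
Qed.

Fixpoint lin_span X (s : seq X) : set X :=
  if s is x :: s' then [set y | exists c z, lin_span s' z /\ y = c *: x + z]
  else [set 0].

Lemma lin_span_submodule X (s : seq X) : is_submodule (lin_span s).
Proof.
elim: s => [|x s [s0 hs]]; first exact: set0_submodule.
split; first by exists 0, 0; rewrite scale0r addr0.
move=> a _ _ [c [z [sz ->]]] [c' [z' [sz' ->]]].
exists (a * c + c'), (a *: z + z'); split; first exact: hs.
by rewrite scalerDr scalerA scalerDl addrACA.
Qed.

Lemma lin_span_sub X (s : seq X) (N : set X) :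
  is_submodule N -> {in s, forall x, N x} -> lin_span s `<=` N.
Proof.
move=> hN; elim: s => [|x s IH] sN y /=; first by move=> ->; exact: submodule0.
case=> c [z [sz ->]]; apply: submoduleD => //.
  by apply: submoduleZ => //; apply: sN; rewrite mem_head.
by apply: IH sz => u us; apply: sN; rewrite inE us orbT.
Qed.

Lemma mem_lin_span X (s : seq X) x : x \in s -> lin_span s x.
Proof.
elim: s => // y s IH; rewrite inE => /orP[/eqP->|/IH sx] /=.
  by exists 1, 0; rewrite scale1r addr0; split=> //; apply: submodule0 (lin_span_submodule s).
by exists 0, x; rewrite scale0r add0r.
Qed.

Lemma lin_span_subset X (s t : seq X) : {subset s <= t} -> lin_span s `<=` lin_span t.
Proof.
move=> st; apply: lin_span_sub; first exact: lin_span_submodule.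
by move=> x /st /mem_lin_span.
Qed.

Lemma lin_span_map X Y (f : {linear X -> Y}) (s : seq X) : lin_span (map f s) = f @` lin_span s.
Proof.
apply/seteqP; split.
  apply: lin_span_sub; first exact/image_submodule/lin_span_submodule.
  by move=> _ /mapP[x xs ->]; exists x => //; exact: mem_lin_span.
suff : lin_span s `<=` f @^-1` lin_span (map f s) by move=> h _ [x /h ? <-].
apply: lin_span_sub; first exact/preimage_submodule/lin_span_submodule.
by move=> x xs; apply: mem_lin_span; exact: map_f.
Qed.

Lemma lin_spanP X (s : seq X) x :
  lin_span s x <-> exists c : nat -> A, x = \sum_(i < size s) c i *: nth 0 s i.
Proof.
elim: s x => [|y s IH] x /=.
  split=> [->|[c ->]]; last by rewrite big_ord0.
  by exists (fun=> 0); rewrite big_ord0.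
split=> [[c [z [/IH[c' ->] ->]]]|[c ->]].
  by exists (fun i => if i is j.+1 then c' j else c); rewrite big_ord_recl.
exists (c 0%N), (\sum_(i < size s) c i.+1 *: nth 0 s i); split.
  by apply/IH; exists (c \o succn).
by rewrite big_ord_recl.
Qed.

Lemma finitely_generatedP X :
  finitely_generated X <-> exists s : seq X, forall x, lin_span s x.
Proof.
split=> [[n [g gX]]|[s sX]].
  exists (codom g) => x; have [c ->] := gX x.
  have := lin_span_submodule (codom g); move: (lin_span _) (@mem_lin_span _ (codom g)) => N gN hN.
  elim/big_ind: _ => [|y z Ny Nz|i _]; first exact: submodule0.
    exact: submoduleD.
  by apply: submoduleZ => //; apply: gN; exact: codom_f.
exists (size s), (fun i => nth 0 s i) => x.
by have /lin_spanP[c ->] := sX x; exists (fun i => c i).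
Qed.

Lemma finitely_generated_surj X Y (f : {linear X -> Y}) :
  range f = [set: Y] -> finitely_generated X -> finitely_generated Y.
Proof.
move=> fT /finitely_generatedP[s sX]; apply/finitely_generatedP; exists (map f s) => y.
by rewrite lin_span_map; have [x <-] := (surjP f).1 fT y; exists x.
Qed.

(** The extension argument for chain conditions: a chain [I] in [N + A x] is
    determined, by the modular law, by its traces on [N] and by the left ideals
    of those [c] with [c x] in [I + N], and both stabilise. *)
Lemma dcc_on_line X (N : set X) x :
  artinian_module (A^o : lmodType A) -> is_submodule N -> dcc_on N ->
  dcc_on [set y | exists c z, N z /\ y = c *: x + z].
Proof.
move=> artA hN dN I hI IN dI.
pose J n : set A^o := [set c | exists2 z, N z & I n ((c : A) *: x + z)].
have [n|n c [z Nz Iz]|n1 n1P] := artA J.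
- split; first by exists 0; rewrite ?scale0r ?addr0; apply: submodule0.
  move=> a c c' [z Nz Iz] [z' Nz' Iz']; exists (a *: z + z').
    by case: hN => _; apply.
  rewrite scalerDl -[(a *: c : A^o)]/(a * c) -scalerA addrACA -scalerDr.
  by case: (hI n) => _; apply.
- by exists z => //; exact: dI.
have [n|n|n|n2 n2P] := dN (fun n => I n `&` N).
- exact: setI_submodule.
- by move=> y [].
- by move=> y [Iy Ny]; split=> //; exact: dI.
exists (maxn n1 n2) => m; rewrite geq_max => /andP[n1m n2m].
have n1k := leq_maxl n1 n2; have n2k := leq_maxr n1 n2; set k := maxn n1 n2 in n1k n2k *.
wlog km : m k n1m n2m n1k n2k / (k <= m)%N.
  by move=> wl; have [/wl|/ltnW/wl ->] := leqP k m; first exact.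
apply/seteqP; split; first exact: decreasing_le.
move=> y Iy; have [c [z [Nz yE]]] := IN _ _ Iy.
have [z' Nz' Iz'] : J m c by rewrite n1P // -(n1P k) //; exists z; rewrite -?yE.
have Iyz : (I k `&` N) (z - z').
  split; last exact: submoduleB.
  have -> : z - z' = y - (c *: x + z') by rewrite yE opprD addrACA subrr add0r.
  by apply: submoduleB => //; exact: decreasing_le km _ Iz'.
have [Imz _] : (I m `&` N) (z - z') by rewrite n2P // -(n2P k).
have -> : y = (c *: x + z') + (z - z') by rewrite yE [z - z']addrC addrA addrK.
exact: submoduleD.
Qed.

Lemma dcc_on_span X (s : seq X) :
  artinian_module (A^o : lmodType A) -> dcc_on (lin_span s).
Proof.
move=> artA; elim: s => [|x s IH]; last exact: dcc_on_line (lin_span_submodule s) IH.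
move=> I hI I0 dI; exists 0%N => m _.
have e n : I n = [set 0].
  by apply/seteqP; split; [exact: I0 | move=> _ ->; exact: submodule0].
by rewrite !e.
Qed.

End Chains.

(** * Submodules of finitely generated modules over an artinian commutative ring *)

Section Noetherian.
Variables (k : comNzRingType) (artk : artinian_module (k^o : lmodType k)).
Implicit Types X : lmodType k.

Definition fg_set X (N : set X) : Prop := exists s, N = lin_span s.

(** A module is finitely generated when an image and the corresponding kernel
    are: lift the generators of the image. *)
Lemma fg_set_extension X (f : {linear X -> X}) (N : set X) :
  is_submodule N -> fg_set (f @` N) -> fg_set (N `&` kernel f) -> fg_set N.
Proof.
move=> hN [t ft] [u Ku].
have [t' [tE t'N]] : exists t', map f t' = t /\ {in t', forall x, N x}.
  have {ft} : {in t, forall y, (f @` N) y} by rewrite ft => y; exact: mem_lin_span.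
  elim: t => [|y t IH] tN; first by exists [::].
  have [|t' [<- t'N]] := IH; first by move=> z zt; apply: tN; rewrite inE zt orbT.
  have [x Nx <-] := tN y (mem_head _ _).
  by exists (x :: t'); split=> // z; rewrite inE => /orP[/eqP->|/t'N].
exists (t' ++ u); apply/seteqP; split; last first.
  apply: lin_span_sub => // x; rewrite mem_cat => /orP[/t'N//|xu].
  by have [] : (N `&` kernel f) x by rewrite Ku; exact: mem_lin_span.
move=> x Nx; have : lin_span (map f t') (f x) by rewrite tE -ft; exists x.
rewrite lin_span_map => -[z tz fz]; rewrite -[x](subrK z).
apply: submoduleD; first exact: lin_span_submodule; last first.
  by apply: lin_span_subset tz => w wt; rewrite mem_cat wt.
have : lin_span u (x - z).
  rewrite -Ku; split; last by rewrite /kernel /= linearB fz subrr.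
  by apply: submoduleB => //; apply: lin_span_sub tz.
by apply: lin_span_subset => w wu; rewrite mem_cat wu orbT.
Qed.

(** The powers of [c] generate a stationary chain of ideals, so
    [c^n = c^(n+1) r] for some [n] and [r]. On [N], where [c^n] is onto, this
    says that [r c] is the identity. *)
Lemma surjective_scalar_invertible X (N : set X) (c : k) :
  (forall x, N x -> exists2 y, N y & c *: y = x) ->
  exists r, forall x, N x -> r *: (c *: x) = x.
Proof.
move=> cN; pose I n : set k^o := [set c ^+ n * r | r in [set: k]].
have [n|n _ [r _ <-]|n /(_ _ (leqnSn n)) In] := @artk I.
- split; first by exists 0; rewrite ?mulr0.
  move=> a _ _ [r _ <-] [r' _ <-]; exists (a * r + r') => //.
  by rewrite mulrDr mulrCA.
- by exists (c * r) => //; rewrite exprSr mulrA.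
have [r _ rE] : I n.+1 (c ^+ n) by rewrite In; exists 1; rewrite ?mulr1.
exists r => x Nx.
have [y Ny <-] : exists2 y, N y & c ^+ n *: y = x.
  elim: n x Nx {In rE} => [|n IH] x Nx; first by exists x; rewrite ?scale1r.
  have [y Ny <-] := cN x Nx; have [z Nz <-] := IH y Ny.
  by exists z; rewrite // exprS scalerA.
by rewrite !scalerA -mulrA -exprS mulrC rE.
Qed.

(** A minimal counterexample [N] has only finitely generated proper submodules.
    Comparing [N] with [c N] and with the kernel of [c], every scalar [c] is
    either zero or invertible on [N]; so [N] behaves like a vector space. A
    submodule maximal among those missing some [x <> 0] then meets [N] in a
    complement of the line through [x]; it is finitely generated, and so is [N]. *)
Lemma fg_submodule X (s : seq X) (N : set X) :
  is_submodule N -> N `<=` lin_span s -> fg_set N.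
Proof.
move=> hN0 Ns; apply: contrapT => nfgN.
pose F (M : set X) := [/\ is_submodule M, M `<=` lin_span s & ~ fg_set M].
have [|||{hN0 Ns nfgN}{}N [[hN Ns nfgN] Nmin]] := @dcc_minimal _ X (lin_span s) F N.
- exact: dcc_on_span.
- by move=> M [].
- by [].
have properfg M : is_submodule M -> M `<=` N -> M <> N -> fg_set M.
  move=> hM MN neMN; apply: contrapT => nfgM; apply/neMN/Nmin => //.
  by split=> //; exact: subset_trans Ns.
have dichotomy (c : k) : (forall x, N x -> c *: x = 0) \/
    (exists r, forall x, N x -> r *: (c *: x) = x).
  pose f : {linear X -> X} := *:%R c.
  have [fN|nfN] := pselect (f @` N = N).
    right; apply: surjective_scalar_invertible => x Nx.
    by have : (f @` N) x by rewrite fN.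
  have [KN|nKN] := pselect (N `&` kernel f = N).
    by left=> x; rewrite -[X in X x]KN => -[].
  case: nfgN; apply: (fg_set_extension (f := f) hN).
    apply: properfg => //; first exact: image_submodule.
    by move=> _ [x Nx <-]; exact: submoduleZ.
  apply: properfg; [|by move=> x []|by []].
  exact: setI_submodule (kernel_submodule f).
have [x Nx x0] : exists2 x, N x & x <> 0.
  apply: contrapT => N0; apply: nfgN; exists [::]; apply/seteqP; split; last first.
    by move=> _ ->; exact: submodule0.
  by move=> x Nx; apply: contrapT => x0; apply: N0; exists x.
(* In [N], the part of [H] is a hyperplane complementary to [x]. *)
have [|y -> x0'|H [hH _ Hx Hmax]] := @maximal_submodule_avoiding _ X [set 0] [set x].
- exact: set0_submodule.
- exact/x0/esym.
have {}Hx : ~ H x by move/Hx; apply.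
have [|||u HNu] := properfg (H `&` N).
- exact: setI_submodule.
- by move=> y [].
- by move=> HN; apply: Hx; move: Nx; rewrite -[X in X x]HN => -[].
apply: nfgN; exists (x :: u); apply/seteqP; split; last first.
  apply: lin_span_sub => // y; rewrite inE => /orP[/eqP->//|yu].
  by have [] : (H `&` N) y by rewrite HNu; exact: mem_lin_span.
move=> y Ny.
have [Hy|nHy] := pselect (H y).
  by exists 0, y; rewrite scale0r add0r -HNu.
pose H' : set X := [set z | exists c h, H h /\ z = c *: y + h].
have [[c [h [Hh xE]]]|nH'x] := pselect (H' x); last first.
  case: nHy; apply: (Hmax H').
  - split; first by exists 0, 0; rewrite scale0r addr0; split=> //; exact: submodule0.
    move=> a _ _ [c [h [Hh ->]]] [c' [h' [Hh' ->]]].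
    exists (a * c + c'), (a *: h + h'); split; first by case: hH => _; apply.
    by rewrite scalerDr scalerA scalerDl addrACA.
  - by move=> h Hh; exists 0, h; rewrite scale0r add0r.
  - by move=> z H'z zx; apply: nH'x; rewrite -zx.
  - by exists 1, 0; rewrite scale1r addr0; split=> //; exact: submodule0.
have [c0|[r rc]] := dichotomy c.
  by case: Hx; rewrite xE c0 // add0r.
exists r, (- (r *: h)); split; last first.
  by rewrite xE scalerDr rc // addrK.
rewrite -HNu -scaleN1r; split; first exact: submoduleZ (submoduleZ _ hH Hh).
suff Nh : N h by exact: submoduleZ (submoduleZ _ hN Nh).
have -> : h = x - c *: y by rewrite xE addrAC subrr add0r.
by apply: submoduleB => //; exact: submoduleZ.
Qed.

End Noetherian.

(** * Finiteness over an artin algebra *)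

Section RestrictScalars.
Variables (k : comNzRingType) (A : algType k).

(** An alias, so that the module structures over [A] and over [k] on the same
    carrier do not compete. *)
Definition restrict_scalars (X : lmodType A) : Type := X.

Section Instance.
Variable X : lmodType A.
HB.instance Definition _ := GRing.Zmodule.on (restrict_scalars X).

Let scale (c : k) (x : restrict_scalars X) : restrict_scalars X := c%:A *: (x : X).

Let scaleA a b v : scale a (scale b v) = scale (a * b) v.
Proof. by rewrite /scale scalerA mulr_algl scalerA. Qed.

Let scale1 : left_id 1 scale.
Proof. by move=> v; rewrite /scale !scale1r. Qed.

Let scaleDr : right_distributive scale +%R.
Proof. by move=> a u v; rewrite /scale scalerDr. Qed.

Let scaleDl v : {morph scale^~ v : a b / a + b}.
Proof. by move=> a b; rewrite /scale !scalerDl. Qed.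

HB.instance Definition _ :=
  GRing.Zmodule_isLmodule.Build k (restrict_scalars X) scaleA scale1 scaleDr scaleDl.

Lemma restrict_scaleE (c : k) (x : X) :
  c *: (x : restrict_scalars X) = (c%:A *: x : X).
Proof. by []. Qed.

Lemma restrict_submodule (N : set X) :
  is_submodule N -> is_submodule (N : set (restrict_scalars X)).
Proof. by case=> N0 hN; split=> // c x y; exact: hN. Qed.

End Instance.

Hypothesis hA : artin_algebra A.

Lemma finitely_generated_restrict (X : lmodType A) (s : seq X) :
  exists t : seq (restrict_scalars X), lin_span s `<=` lin_span t.
Proof.
have [_ /finitely_generatedP[g gA]] := hA.
pose gx x : seq (restrict_scalars X) := [seq (b : A) *: (x : X) | b <- g].
have gxP a x : lin_span (gx x) (a *: x).
  pose f := fun b : A => b *: x : restrict_scalars X.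
  have [h hE] : exists h : {linear (A : lmodType k) -> restrict_scalars X}, h =1 f.
    apply: linear_map_of => c b b'.
    by rewrite /f scalerDl restrict_scaleE scalerA mulr_algl.
  rewrite -[a *: x]/(f a) -hE -[gx x](eq_map hE) lin_span_map.
  by exists a.
exists (flatten (map gx s)); elim: s => [|x s IH] //= _ [c [z [sz ->]]].
apply: (submoduleD (X := restrict_scalars X)); first exact: lin_span_submodule.
  by apply: lin_span_subset (gxP c x) => y; rewrite mem_cat => ->.
by apply: lin_span_subset (IH _ sz) => y; rewrite mem_cat => ->; rewrite orbT.
Qed.

Lemma artin_algebra_dcc (X : lmodType A) (s : seq X) : dcc_on (lin_span s).
Proof.
have [t st] := finitely_generated_restrict s.
move=> I hI Is dI; have [artk _] := hA.
apply: (@dcc_on_span _ (restrict_scalars X) t artk I) => // n.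
  exact/restrict_submodule/hI.
exact: subset_trans st.
Qed.

Lemma finitely_generated_submodule (X U : lmodType A) (i : {linear U -> X}) :
  injective i -> finitely_generated X -> finitely_generated U.
Proof.
move=> i_inj /finitely_generatedP[s sX]; have [artk _] := hA.
have [t st] := finitely_generated_restrict s.
have [u uE] : fg_set (range i : set (restrict_scalars X)).
  apply: (fg_submodule artk (s := t)); first exact/restrict_submodule/range_submodule.
  by move=> x _; exact: st.
have [u' u'E] : exists u' : seq U, map i u' = u.
  have {uE} : {in u, forall y, (range i) y} by rewrite uE => y; exact: mem_lin_span.
  elim: u => [|y u IH] uN; first by exists [::].
  have [|u' <-] := IH; first by move=> z zt; apply: uN; rewrite inE zt orbT.
  by have [x _ <-] := uN y (mem_head _ _); exists (x :: u').
apply/finitely_generatedP; exists u' => x.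
suff : lin_span (u : seq X) (i x) by rewrite -u'E lin_span_map => -[x' ux' /i_inj <-].
have : (range i) (i x) by exists x.
rewrite uE; apply: lin_span_sub.
  exact/restrict_submodule/lin_span_submodule.
by move=> y yu; exact: mem_lin_span.
Qed.

(** A cyclic submodule satisfies the descending chain condition, so it contains a
    minimal nonzero submodule. *)
Lemma exists_simple_submodule (X : lmodType A) (x : X) : x != 0 ->
  exists (S : lmodType A) (j : {linear S -> X}), simple_module S /\ injective j.
Proof.
move=> x0.
pose F (M : set X) := [/\ is_submodule M, M `<=` lin_span [:: x] & M <> [set 0]].
have [|||M [[hM Mx M0] Mmin]] := @dcc_minimal _ X (lin_span [:: x]) F (lin_span [:: x]).
- exact: artin_algebra_dcc.
- by move=> M [].
- split=> //; first exact: lin_span_submodule.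
  move=> s0; have : lin_span [:: x] x by apply: mem_lin_span; rewrite mem_head.
  by rewrite s0; exact/eqP.
have [S [j [j_inj jM]]] := submodule_as_module hM.
exists S, j; split=> //; split.
  apply: contrapT => S0; apply: M0; rewrite -jM; apply/seteqP; split.
    move=> _ [y _ <-]; have [->|y0] := eqVneq y 0; first by rewrite linear0.
    by case: S0; exists y.
  by move=> _ ->; exists 0; rewrite ?linear0.
move=> N hN.
have [jN0|jN0] := pselect (j @` N = [set 0]).
  left; apply/seteqP; split; last by move=> _ ->; exact: submodule0.
  move=> y Ny; have : (j @` N) (j y) by exists y.
  by rewrite jN0 -(linear0 j) => /j_inj.
right; apply/seteqP; split=> // y _.
have jNM : j @` N `<=` M by rewrite -jM; exact: image_subset.
have jNE : j @` N = M.
  apply: Mmin => //; split=> //; first exact: image_submodule.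
  exact: subset_trans Mx.
have : M (j y) by rewrite -jM; exists y.
by rewrite -jNE => -[y' Ny' /j_inj <-].
Qed.

End RestrictScalars.

(** * Projective modules and projective dimension *)

Section Projectives.
Variable A : nzRingType.
Implicit Types K L M P Q S U V W X Y Z : lmodType A.

Definition short_exact K P M (i : {linear K -> P}) (p : {linear P -> M}) : Prop :=
  [/\ injective i, exact i p & range p = [set: M]].

Lemma kernel_short_exact P M (p : {linear P -> M}) : range p = [set: M] ->
  exists K (i : {linear K -> P}), short_exact i p.
Proof.
move=> pT; have [K [i [i_inj iE]]] := submodule_as_module (kernel_submodule p).
by exists K, i.
Qed.

Lemma quotient_short_exact K P (i : {linear K -> P}) : injective i ->
  exists M (p : {linear P -> M}), short_exact i p.
Proof.
move=> i_inj; have [M [p [pT pE]]] := quotient_module (range_submodule i).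
by exists M, p; split=> //; rewrite /exact pE.
Qed.

Lemma isomorphic_of U V (f : {linear U -> V}) :
  injective f -> range f = [set: V] -> isomorphic U V.
Proof.
move=> f_inj /surjP/choice[g gK]; exists f; exists g => // x.
by apply: f_inj; rewrite gK.
Qed.

Lemma isomorphic_inverse U V : isomorphic U V ->
  exists (f : {linear U -> V}) (g : {linear V -> U}), cancel f g /\ cancel g f.
Proof.
case=> f [g fK gK]; have lg : linear g.
  by move=> a x y; apply: (can_inj fK); rewrite linearP !gK.
by have [h hE] := linear_map_of lg; exists f, h; split=> x; rewrite hE.
Qed.

Lemma isomorphic_refl U : isomorphic U U.
Proof. by exists idfun; exists id. Qed.

Lemma isomorphic_swap X Y : isomorphic (X * Y)%type (Y * X)%type.
Proof.
have ls : linear (fun u : X * Y => (u.2, u.1)) by [].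
have [f fE] := linear_map_of ls; exists f; exists (fun u => (u.2, u.1)) => -[x y];
  by rewrite fE.
Qed.

Lemma pairD X Y (x x' : X) (y y' : Y) : (x, y) + (x', y') = (x + x', y + y').
Proof. by []. Qed.

Lemma linear_pair X Y Z (f : {linear X -> Y}) (g : {linear X -> Z}) :
  exists h : {linear X -> (Y * Z)%type}, forall x, h x = (f x, g x).
Proof.
have lh : linear (fun x => (f x, g x)) by move=> a x y; rewrite !linearP.
by have [h hE] := linear_map_of lh; exists h.
Qed.

Lemma linear_copair X Y Z (f : {linear X -> Z}) (g : {linear Y -> Z}) :
  exists h : {linear (X * Y)%type -> Z}, forall u, h u = f u.1 + g u.2.
Proof.
have lh : linear (fun u : X * Y => f u.1 + g u.2).
  by move=> a x y /=; rewrite !linearP scalerDr addrACA.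
by have [h hE] := linear_map_of lh; exists h.
Qed.

(** The range of [g], as a module, is the target of a surjection through which
    [f] factors. *)
Lemma projective_lift P U V (g : {linear U -> V}) (f : {linear P -> V}) :
  projective P -> (forall x, exists u, g u = f x) ->
  exists h : {linear P -> U}, forall x, g (h x) = f x.
Proof.
move=> projP gf; have [R [i [i_inj iR]]] := submodule_as_module (range_submodule g).
have inR v : range g v -> exists r, i r = v by rewrite -iR => -[r _ <-]; exists r.
have [|g' g'E] := @factor_through_inj _ V U R i g i_inj.
  by move=> u; apply: inR; exists u.
have [|f' f'E] := @factor_through_inj _ V P R i f i_inj.
  by move=> x; apply: inR; have [u <-] := gf x; exists u.
have [|h hE] := projP U R g' f'; last by exists h => x; rewrite -g'E hE f'E.
apply/surjP => r; have : range g (i r) by rewrite -iR; exists r.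
by case=> u _ gu; exists u; apply: i_inj; rewrite g'E.
Qed.

Lemma projective_retract P K (j : {linear K -> P}) (r : {linear P -> K}) :
  cancel j r -> projective P -> projective K.
Proof.
move=> jK projP U V g f gT.
have [h hE] := projP U V g (f \o r : {linear P -> V}) gT.
by exists (h \o j : {linear K -> U}) => x /=; rewrite hE /= jK.
Qed.

Lemma projective_prod P Q : projective P -> projective Q -> projective (P * Q)%type.
Proof.
move=> projP projQ U V g f gT.
have [iP iPE] := linear_pair (idfun : {linear P -> P}) (\0 : {linear P -> Q}).
have [iQ iQE] := linear_pair (\0 : {linear Q -> P}) (idfun : {linear Q -> Q}).
have [hP hPE] := projP U V g (f \o iP : {linear P -> V}) gT.
have [hQ hQE] := projQ U V g (f \o iQ : {linear Q -> V}) gT.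
have [h hE] := linear_copair hP hQ; exists h => -[x y].
by rewrite hE linearD hPE hQE /= -linearD iPE iQE /= pairD addr0 add0r.
Qed.

Lemma projective_free n : projective ('rV[A]_n : lmodType A).
Proof.
move=> U V g f /surjP gT.
have /choice[u uE] : forall i : 'I_n, exists u, g u = f (delta_mx 0 i) by move=> i.
have lh : linear (fun v : 'rV[A]_n => \sum_i v 0 i *: u i).
  move=> a x y; rewrite scaler_sumr -big_split; apply: eq_bigr => i _.
  by rewrite !mxE scalerDl scalerA.
have [h hE] := linear_map_of lh; exists h => v.
rewrite hE linear_sum [in RHS](row_sum_delta v) linear_sum.
by apply: eq_bigr => i _; rewrite !linearZ /= uE.
Qed.

Lemma finitely_generated_free n : finitely_generated ('rV[A]_n : lmodType A).
Proof.
exists n, (fun i => delta_mx 0 i) => v; exists (fun i => v 0 i).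
exact: row_sum_delta.
Qed.

Lemma free_presentation M : finitely_generated M ->
  exists n (e : {linear 'rV[A]_n -> M}), range e = [set: M].
Proof.
case=> n [g gM]; have le : linear (fun v : 'rV[A]_n => \sum_i v 0 i *: g i).
  move=> a x y; rewrite scaler_sumr -big_split; apply: eq_bigr => i _.
  by rewrite !mxE scalerDl scalerA.
have [e eE] := linear_map_of le; exists n, e; apply/surjP => x.
have [c ->] := gM x; exists (\row_i c i); rewrite eE.
by apply: eq_bigr => i _; rewrite mxE.
Qed.

Lemma finitely_generated_prod X Y :
  finitely_generated X -> finitely_generated Y -> finitely_generated (X * Y)%type.
Proof.
move=> /finitely_generatedP[s sX] /finitely_generatedP[t tY].
have [iX iXE] := linear_pair (idfun : {linear X -> X}) (\0 : {linear X -> Y}).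
have [iY iYE] := linear_pair (\0 : {linear Y -> X}) (idfun : {linear Y -> Y}).
apply/finitely_generatedP; exists (map iX s ++ map iY t) => -[x y].
have -> : (x, y) = iX x + iY y by rewrite iXE iYE /= pairD addr0 add0r.
apply: submoduleD; first exact: lin_span_submodule.
  apply: (@lin_span_subset _ _ (map iX s)) => [z|]; first by rewrite mem_cat => ->.
  by rewrite lin_span_map; exists x.
apply: (@lin_span_subset _ _ (map iY t)) => [z|]; first by rewrite mem_cat orbC => ->.
by rewrite lin_span_map; exists y.
Qed.

(** Both sides are the fibre product of [P] and [Q] over [M]; the isomorphism is
    written out with lifts [a : Q -> P] and [b : P -> Q] over [M]. *)
Lemma schanuel K P L Q M (i : {linear K -> P}) (p : {linear P -> M})
    (j : {linear L -> Q}) (q : {linear Q -> M}) :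
  projective P -> projective Q -> short_exact i p -> short_exact j q ->
  isomorphic (K * Q)%type (P * L)%type.
Proof.
move=> projP projQ [i_inj /exactP[pi0 ipe] pT] [j_inj /exactP[qj0 jqe] qT].
have [a aE] := projQ _ _ p q pT; have [b bE] := projP _ _ q p qT.
have [h hE] := linear_copair i a.
have [|l lE] := @factor_through_inj _ Q _ L j
   ((snd : {linear (K * Q)%type -> Q}) \- (b \o h)) j_inj.
  case=> x y; apply: jqe.
  by rewrite linearB /= bE hE linearD pi0 aE /= add0r subrr.
have [f fE] := linear_pair h l; apply: (isomorphic_of (f := f)).
  apply: injectiveP0 => -[x y]; rewrite fE => -[hxy0 lxy0].
  have y0 : y = 0.
    have := lE (x, y); rewrite lxy0 linear0 /= hxy0 linear0 subr0 //.
  congr (_, _); last exact: y0.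
  by apply: i_inj; rewrite linear0; move: hxy0; rewrite hE y0 /= linear0 addr0.
apply/surjP => -[x z]; pose y := j z + b x.
have [w wE] : exists w, i w = x - a y.
  by apply: ipe; rewrite linearB aE linearD qj0 add0r bE subrr.
exists (w, y); have hwy : h (w, y) = x by rewrite hE /= wE subrK.
rewrite fE hwy; congr (_, _); apply: j_inj.
by rewrite lE /= hwy /y addrK.
Qed.

(** Projective dimension at most [n], with every choice of presentation allowed.
    The universal form can be applied to the presentations built by the horseshoe
    lemma; [resolution_pd_le] obtains it from one resolution. *)
Fixpoint pd_le n M : Prop :=
  if n is n'.+1 then
    forall K P (i : {linear K -> P}) (p : {linear P -> M}),
      projective P -> short_exact i p -> pd_le n' K
  else projective M.

Lemma pd_le_isomorphic n M M' : isomorphic M M' -> pd_le n M -> pd_le n M'.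
Proof.
move=> /isomorphic_inverse[f [g [fK gK]]]; case: n => [|n] /= pdM.
  exact: projective_retract gK pdM.
move=> K P i p projP [i_inj /exactP[pi0 ipe] /surjP pT].
apply: (pdM K P i (g \o p : {linear P -> M})) => //; split=> //.
  apply/exactP; split=> [x|y gpy] /=; first by rewrite pi0 linear0.
  by apply: ipe; apply: (can_inj gK); rewrite linear0.
by apply/surjP => x; have [y yE] := pT (f x); exists y; rewrite /= yE fK.
Qed.

(** A presentation of [K] plus the identity of [P] presents [K * P]. *)
Lemma pd_le_summand n K P : projective P -> pd_le n (K * P)%type -> pd_le n K.
Proof.
move=> projP; case: n => [|n] /= pdKP.
  have [iK iKE] := linear_pair (idfun : {linear K -> K}) (\0 : {linear K -> P}).
  apply: (@projective_retract _ _ iK (fst : {linear (K * P)%type -> K})) pdKP.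
  by move=> x; rewrite iKE.
move=> W Q i p projQ [i_inj /exactP[pi0 ipe] /surjP pT].
have [j jE] := linear_pair i (\0 : {linear W -> P}).
have [q qE] := linear_pair (p \o fst : {linear (Q * P)%type -> K})
  (snd : {linear (Q * P)%type -> P}).
apply: (pdKP W _ j q); first exact: projective_prod.
split.
- by apply: injectiveP0 => x; rewrite jE => -[ix0]; apply: i_inj; rewrite linear0.
- apply/exactP; split=> [x|[y z]]; first by rewrite qE jE /= pi0.
  by rewrite qE /= => -[/ipe[x <-] ->]; exists x; rewrite jE.
- by apply/surjP => -[x z]; have [y yE] := pT x; exists (y, z); rewrite qE /= yE.
Qed.

(** Given a presentation [W -> Q -> K * P], split off [P]: the kernel of
    [Q -> K] is [W * P], and it is the syzygy of a presentation of [K]. *)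
Lemma pd_le_prod n K P : projective P -> pd_le n K -> pd_le n (K * P)%type.
Proof.
move=> projP; case: n => [|n] /= pdK; first exact: projective_prod.
move=> W Q i p projQ [i_inj /exactP[pi0 ipe] pT].
have [iP iPE] := linear_pair (\0 : {linear P -> K}) (idfun : {linear P -> P}).
have [s sE] := projP _ _ p iP pT.
have [j jE] := linear_copair i s.
apply: (@pd_le_summand n W P projP).
apply: (pdK _ _ j (fst \o p : {linear Q -> K})) => //; split.
- apply: injectiveP0 => -[w y]; rewrite jE /= => wy0.
  have y0 : y = 0.
    have := congr1 p wy0; rewrite linearD pi0 sE iPE linear0 add0r.
    by case.
  by congr (_, _) => //; apply: i_inj; move: wy0; rewrite y0 !linear0 addr0.
- apply/exactP; split=> [[w y]|x].
    by rewrite /= jE linearD pi0 sE iPE add0r.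
  move=> /= px0; have [w wE] : exists w, i w = x - s (p x).2.
    apply: ipe; rewrite linearB sE iPE.
    by case: (p x) px0 => u v /= ->; rewrite subrr.
  by exists (w, (p x).2); rewrite jE /= wE subrK.
- apply/surjP => x; have [y yE] := (surjP p).1 pT (x, 0).
  by exists y; rewrite /= yE.
Qed.

(** Schanuel's lemma compares the first syzygy of the given resolution with that
    of any other presentation, up to projective summands. *)
Lemma resolution_pd_le M n : has_projective_resolution M n -> pd_le n M.
Proof.
elim: n M => [|n IH] M [P [d [e [projP P0 eT de dd]]]].
  have e_inj : injective e.
    apply: injectiveP0 => x ex0; have /exactP[_ /(_ x ex0)[y <-]] := de.
    by rewrite (P0 1%N isT y) linear0.
  apply: (@pd_le_isomorphic 0 (P 0%N)); last exact: projP.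
  exact: isomorphic_of eT.
have [K [i iex]] := kernel_short_exact eT; have [i_inj /exactP[ei0 eie] _] := iex.
have /exactP[ed0 ede] := de.
have [|e' e'E] := @factor_through_inj _ _ _ _ i (d 0%N) i_inj.
  by move=> x; exact/eie/ed0.
have pdK : pd_le n K.
  apply: IH; exists (fun j => P j.+1), (fun j => d j.+1), e'; split=> //.
  - by move=> j nj; exact: P0.
  - apply/surjP => x; have [y yE] := ede (i x) (ei0 x).
    by exists y; apply: i_inj; rewrite e'E.
  - have /exactP[dd0 dde] := dd 0%N.
    apply/exactP; split=> [x|y e'y]; first by apply: i_inj; rewrite e'E dd0 linear0.
    by apply: dde; rewrite -e'E e'y linear0.
move=> L Q j q projQ jex.
apply: (pd_le_summand (projP 0%N)); apply: pd_le_isomorphic (isomorphic_swap _ _) _.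
apply: pd_le_isomorphic (schanuel (projP 0%N) projQ iex jex) _.
exact: pd_le_prod.
Qed.

End Projectives.

(** * Syzygies *)

Section Syzygies.
Variable A : nzRingType.
Implicit Types K L M P Q S U V W X Y Z KX KY KZ PX PZ : lmodType A.

Lemma syzygy_isomorphic M K L : isomorphic L K -> is_syzygy M K -> is_syzygy M L.
Proof.
move=> /isomorphic_inverse[f [g [fK gK]]] [P [p [i [pcov i_inj /exactP[pi0 ipe]]]]].
exists P, p, (i \o f : {linear L -> P}); split=> //.
  by move=> x y /= /i_inj; exact: (can_inj fK).
apply/exactP; split=> [x|y /ipe[x <-]]; first exact: pi0.
by exists (g x); rewrite /= gK.
Qed.

(** Iterated syzygies are defined by adding the last step; inductions over short
    exact sequences remove the first one. *)
Lemma nsyzygy_shift n M K L : is_syzygy M K -> is_nsyzygy n K L -> is_nsyzygy n.+1 M L.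
Proof.
move=> MK; elim: n L => [|n IH] L /=.
  by move=> LK; exists M; split; [exact: isomorphic_refl | exact: syzygy_isomorphic MK].
by case=> L' [KL' L'L]; exists L'; split=> //; exact: IH.
Qed.

(** The kernels of the iterates of [h] form an ascending chain whose union is
    finitely generated, hence equal to the kernel of some [iter n h]. If
    [h x = 0], write [x = iter n h y]; then [iter n.+1 h y = 0], so already
    [iter n h y = 0]. *)
Lemma surjective_endo_injective U (h : {linear U -> U}) :
  (forall N : set U, is_submodule N -> exists s, N = lin_span s) ->
  range h = [set: U] -> injective h.
Proof.
move=> noethU /surjP hT.
have kerS n : is_submodule [set x | iter n h x = 0].
  split; first by elim: n => //= n ->; rewrite linear0.
  move=> a x y /= x0 y0; have -> : iter n h (a *: x + y) = a *: iter n h x + iter n h y.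
    by elim: n {x0 y0} => //= n ->; rewrite linearP.
  by rewrite x0 y0 scaler0 addr0.
have kerM m n x : (m <= n)%N -> iter m h x = 0 -> iter n h x = 0.
  by move=> /subnK <- x0; rewrite iterD x0; have [] := kerS (n - m)%N.
have [|s sE] := noethU [set x | exists n, iter n h x = 0].
  split; first by exists 0%N.
  move=> a x y [m x0] [n y0]; exists (maxn m n); have [_ ] := kerS (maxn m n).
  by apply; apply: kerM; [exact: leq_maxl|exact: x0|exact: leq_maxr|exact: y0].
have [n sn] : exists n, {in s, forall x, iter n h x = 0}.
  have : {in s, forall x, exists n, iter n h x = 0}.
    by move=> x /mem_lin_span; rewrite -sE.
  elim: s {sE} => [|x s IH] sn; first by exists 0%N.
  have [|n sn'] := IH; first by move=> y ys; apply: sn; rewrite inE ys orbT.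
  have [m xm] := sn x (mem_head _ _); exists (maxn m n) => y.
  rewrite inE => /orP[/eqP->|/sn' y0]; first exact: kerM (leq_maxl _ _) xm.
  exact: kerM (leq_maxr _ _) y0.
have iterT m x : exists y, iter m h y = x.
  elim: m x => [|m IH] x; first by exists x.
  by have [y <-] := IH x; have [z <-] := hT y; exists z; rewrite iterSr.
apply: injectiveP0 => x hx0; have [y yx] := iterT n x.
rewrite -yx; have : lin_span s y by rewrite -sE; exists n.+1; rewrite /= yx.
by apply: (lin_span_sub (kerS n)).
Qed.

(** On [PZ] the map [pY] is a lift of [pZ] along [p]; on [PX] it is [i \o pX]. *)
Lemma horseshoe X Y Z KX PX KZ PZ (i : {linear X -> Y}) (p : {linear Y -> Z})
    (iX : {linear KX -> PX}) (pX : {linear PX -> X})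
    (iZ : {linear KZ -> PZ}) (pZ : {linear PZ -> Z}) :
  projective PZ -> short_exact i p -> short_exact iX pX -> short_exact iZ pZ ->
  exists KY (iY : {linear KY -> (PX * PZ)%type}) (pY : {linear (PX * PZ)%type -> Y})
    (u : {linear KX -> KY}) (v : {linear KY -> KZ}),
    short_exact iY pY /\ short_exact u v.
Proof.
move=> projPZ [i_inj /exactP[pi0 ipe] pT] [iX_inj /exactP[pX0 iXe] /surjP pXT].
move=> [iZ_inj /exactP[pZ0 iZe] /surjP pZT].
have [s sE] := projPZ _ _ p pZ pT.
have [pY pYE] := linear_copair (i \o pX : {linear PX -> Y}) s.
have [|KY [iY iYex]] := @kernel_short_exact _ _ _ pY.
  apply/surjP => y; have [b bE] := pZT (p y).
  have [x xE] : exists x, i x = y - s b by apply: ipe; rewrite linearB sE bE subrr.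
  by have [a aE] := pXT x; exists (a, b); rewrite pYE /= aE xE subrK.
have [iY_inj /exactP[pY0 iYe] _] := iYex.
have [j jE] := linear_pair iX (\0 : {linear KX -> PZ}).
have [|u uE] := @factor_through_inj _ _ _ _ iY j iY_inj.
  by move=> x; apply: iYe; rewrite pYE jE /= pX0 !linear0 addr0.
have [|v vE] := @factor_through_inj _ _ _ _ iZ
    ((snd : {linear (PX * PZ)%type -> PZ}) \o iY) iZ_inj.
  move=> w; apply: iZe; rewrite /= -sE -[RHS](linear0 p) -(pY0 w) pYE.
  by rewrite linearD /= pi0 add0r.
exists KY, iY, pY, u, v; split=> //; split.
- apply: injectiveP0 => x ux0; have := uE x; rewrite ux0 linear0 jE => /(congr1 fst) /= iX0.
  by apply: iX_inj; rewrite linear0.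
- apply/exactP; split=> [x|w vw0].
    by apply: iZ_inj; rewrite vE /= uE jE linear0.
  have w2 : (iY w).2 = 0 by have := vE w; rewrite vw0 linear0 /= => <-.
  have [x xE] : exists x, iX x = (iY w).1.
    apply: iXe; apply: i_inj; have := pY0 w.
    by rewrite pYE w2 !linear0 addr0.
  exists x; apply: iY_inj; rewrite uE jE xE.
  by case: (iY w) w2 => a b /= ->.
- apply/surjP => z.
  have [x xE] : exists x, i x = - s (iZ z).
    by apply: ipe; rewrite linearN sE pZ0 oppr0.
  have [a aE] := pXT x.
  have [w wE] : exists w, iY w = (a, iZ z) by apply: iYe; rewrite pYE /= aE xE addNr.
  by exists w; apply: iZ_inj; rewrite vE /= wE.
Qed.

End Syzygies.

(** * Projective covers and delooping over an artin algebra *)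

Section ArtinAlgebra.
Variables (k : comNzRingType) (A : algType k).
Hypothesis hA : artin_algebra A.
Implicit Types K L M P Q S U V W X Y Z KX KY KZ PX PZ : lmodType A.

(** In a free module [F] mapping onto [M] by [e], take a submodule [U] minimal
    among those still mapping onto [M]. A lift [h : F -> U] of [e] over [M]
    restricts to an endomorphism of [U] that is onto by minimality, hence
    bijective; so [U] is a retract of [F] and therefore projective. Minimality
    also says that the kernel of [U -> M] is superfluous. *)
Lemma exists_projective_cover M : finitely_generated M ->
  exists P (p : {linear P -> M}), projective_cover p /\ finitely_generated P.
Proof.
move=> fgM; have [n [e eT]] := free_presentation fgM.
have fgF := finitely_generated_free A n.
pose F (U : set 'rV[A]_n) := is_submodule U /\ forall m, exists2 u, U u & e u = m.
have [s sF] := (finitely_generatedP _).1 fgF.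
have [|||UF [[hUF UFe] UFmin]] := @dcc_minimal _ 'rV[A]_n (lin_span s) F setT.
- exact: artin_algebra_dcc.
- by move=> U [hU _]; split=> // x _; exact: sF.
- split; first exact: setT_submodule.
  by move=> m; have [x <-] := (surjP e).1 eT m; exists x.
have [U [i [i_inj iU]]] := submodule_as_module hUF.
pose f := e \o i : {linear U -> M}.
have fT : range f = [set: M].
  by apply/surjP => m; have [x + <-] := UFe m; rewrite -iU => -[u _ <-]; exists u.
have projF : projective 'rV[A]_n by exact: projective_free.
have [h hE] := projF _ _ f e fT.
have Umin N : is_submodule N -> (forall m, exists2 u, N u & f u = m) -> N = [set: U].
  move=> hN Nf; have iNE : i @` N = UF.
    apply: UFmin; last by rewrite -iU; exact: image_subset.
    split; first exact: image_submodule.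
    by move=> m; have [u Nu <-] := Nf m; exists (i u) => //; exists u.
  apply/seteqP; split=> // u _; have : UF (i u) by rewrite -iU; exists u.
  by rewrite -iNE => -[v Nv /i_inj <-].
pose g := h \o i : {linear U -> U}.
have gT : range g = [set: U].
  apply: Umin; first exact: range_submodule.
  move=> m; have [u <-] := (surjP f).1 fT m; exists (g u); first by exists u.
  exact: hE.
have fgU : finitely_generated U by exact: (finitely_generated_submodule hA i_inj).
have g_inj : injective g.
  apply: surjective_endo_injective gT => N hN.
  have [V [j [j_inj <-]]] := submodule_as_module hN.
  have /finitely_generatedP[t tV] := finitely_generated_submodule hA j_inj fgU.
  by exists (map j t); rewrite lin_span_map; apply/seteqP; split=> _ [x _ <-]; exists x.
have [|g' gK] := @factor_through_inj _ U U U g idfun g_inj.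
  by move=> y; exact: (surjP g).1 gT y.
have g'K : cancel g g' by move=> x; apply: g_inj; rewrite gK.
have projU : projective U.
  by apply: (projective_retract (j := i) (r := g' \o h)) projF => x; exact: g'K.
exists U, f; split=> //; split=> // N hN NU; apply: Umin => // m.
have [u <-] := (surjP f).1 fT m; have [y [z [Ny fz ->]]] := NU u.
by exists y => //; rewrite linearD fz addr0.
Qed.

Lemma exists_syzygy M : finitely_generated M ->
  exists K P (i : {linear K -> P}) (p : {linear P -> M}),
    [/\ finitely_generated K, finitely_generated P, projective P,
        short_exact i p & is_syzygy M K].
Proof.
move=> fgM; have [P [p [pcov fgP]]] := exists_projective_cover fgM.
have [projP pT _] := pcov.
have [K [i iex]] := kernel_short_exact pT; have [i_inj ipe _] := iex.
exists K, P, i, p; split=> //; first exact: (finitely_generated_submodule hA i_inj).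
by exists P, p, i.
Qed.

(** For [n = 0] the middle term is projective and Schanuel's lemma applies; the
    horseshoe lemma reduces [n.+1] to [n]. *)
Lemma syzygy_of_sub_summand n X Y Z (i : {linear X -> Y}) (p : {linear Y -> Z}) :
  finitely_generated X -> finitely_generated Y -> finitely_generated Z ->
  short_exact i p -> pd_le n Y ->
  exists K P L, [/\ is_nsyzygy n X K, finitely_generated P /\ projective P,
    is_nsyzygy n.+1 Z L & direct_summand K (P * L)%type].
Proof.
elim: n X Y Z i p => [|n IH] X Y Z i p fgX fgY fgZ ipex pdY.
  have [L [Q [j [q [_ _ projQ jqex LZ]]]]] := exists_syzygy fgZ.
  exists X, Y, L; split=> //; first exact: isomorphic_refl.
    by exists Z; split=> //; exact: isomorphic_refl.
  by exists Q; exact: schanuel ipex jqex.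
have [KX [PX [iX [pX [fgKX fgPX projPX iXex XKX]]]]] := exists_syzygy fgX.
have [KZ [PZ [iZ [pZ [fgKZ fgPZ projPZ iZex ZKZ]]]]] := exists_syzygy fgZ.
have [KY [iY [pY [u [v [iYex uvex]]]]]] := horseshoe projPZ ipex iXex iZex.
have fgKY : finitely_generated KY.
  have [iY_inj _ _] := iYex.
  apply: (finitely_generated_submodule hA iY_inj); exact: (finitely_generated_prod fgPX fgPZ).
have [|K [P [L [XK PP ZL KPL]]]] := IH _ _ _ u v fgKX fgKY fgKZ uvex.
  exact: pdY (projective_prod projPX projPZ) iYex.
exists K, P, L; split=> //; first exact: nsyzygy_shift XKX XK.
exact: nsyzygy_shift ZKZ ZL.
Qed.

Lemma deloops_at_of_embedding S M n :
  embeds_in S M -> finitely_generated M -> has_projective_resolution M n ->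
  deloops_at S n.
Proof.
move=> [i i_inj] fgM /resolution_pd_le pdM.
have [Z [p ipex]] := quotient_short_exact i_inj; have [_ _ pT] := ipex.
have fgS := finitely_generated_submodule hA i_inj fgM.
have fgZ := finitely_generated_surj pT fgM.
have [K [P [L [SK PP ZL KPL]]]] := syzygy_of_sub_summand fgS fgM fgZ ipex pdM.
by exists K, P, Z, L.
Qed.

End ArtinAlgebra.

(** * Injective resolutions and Ext *)

Section InjectiveResolutions.
Variable A : nzRingType.
Implicit Types C D E K L M N P Q S U V W X Y Z : lmodType A.

Lemma injective_isomorphic M M' :
  isomorphic M M' -> injective_module M -> injective_module M'.
Proof.
move=> /isomorphic_inverse[f [g [fK gK]]] injM U V j h j_inj.
have [t tE] := injM U V j (g \o h : {linear U -> M}) j_inj.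
by exists (f \o t : {linear V -> M'}) => x /=; rewrite tE /= gK.
Qed.

Lemma injective_resolution0 N : injective_module N -> has_injective_resolution N 0.
Proof.
move=> injN.
pose I (j : nat) : lmodType A := if j is 0%N then N else 'rV[A]_0.
have I0 j : (0 < j)%N -> forall x : I j, x = 0.
  by case: j => // j _ x; exact: thinmx0.
have injI j : injective_module (I j).
  case: j => [|j]; first exact: injN.
  by move=> U V g f _; exists \0 => x; rewrite [RHS]I0.
exists I, (fun j => \0 : {linear I j -> I j.+1}), (idfun : {linear N -> I 0%N}).
split=> //.
- by apply/exactP; split=> // y _; exists y.
- by move=> j; apply/exactP; split=> // y _; exists 0; rewrite linear0 [RHS]I0.
Qed.

Lemma injective_resolution_cons n N E C (i : {linear N -> E}) (p : {linear E -> C}) :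
  injective_module E -> short_exact i p -> has_injective_resolution C n ->
  has_injective_resolution N n.+1.
Proof.
move=> injE [i_inj /exactP[pi0 ipe] /surjP pT] [I [d [e [injI I0 e_inj]]]].
move=> /exactP[de0 ede] dd.
pose I' j := if j is j'.+1 then I j' else E.
pose d' j : {linear I' j -> I' j.+1} :=
  match j return {linear I' j -> I' j.+1} with
  | 0%N => (e \o p : {linear E -> I 0%N})
  | j'.+1 => d j'
  end.
exists I', d', i; split=> //.
- by case.
- by case=> // j nj; exact: I0.
- apply/exactP; split=> [x|y] /=; first by rewrite pi0 linear0.
  by move=> epy; apply: ipe; apply: e_inj; rewrite linear0.
- case=> [|j] //=; apply/exactP; split=> [x|y /ede[c <-]] /=; first exact: de0.
  by have [x <-] := pT c; exists x.
Qed.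

(** The resolution is peeled from the left, so that only the last term, the
    cosyzygy [C], differs from the given one. *)
Lemma injective_resolution_truncate n N (I : nat -> lmodType A)
    (d : forall j, {linear I j -> I j.+1}) (e : {linear N -> I 0%N})
    C (c : {linear C -> I n}) :
  (forall j, injective_module (I j)) -> injective e -> exact e (d 0%N) ->
  (forall j, exact (d j) (d j.+1)) -> injective_module C -> injective c ->
  exact c (d n) -> has_injective_resolution N n.
Proof.
elim: n N I d e c => [|n IH] N I d e c injI e_inj /exactP[de0 ede] dd injC c_inj.
  move=> /exactP[dc0 cde]; apply: injective_resolution0.
  have [|t tE] := @factor_through_inj _ _ _ _ e c e_inj.
    by move=> y; apply: ede.
  apply: (injective_isomorphic _ injC); apply: (isomorphic_of (f := t)).
    by move=> x y txy; apply: c_inj; rewrite -!tE txy.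
  apply/surjP => x; have [y yE] := cde (e x) (de0 x).
  by exists y; apply: e_inj; rewrite tE.
move=> cex; have [D [j [j_inj jE]]] := submodule_as_module (kernel_submodule (d 1%N)).
have /exactP[dd0 dde] := dd 0%N.
have /exactP[dj0 jde] : exact j (d 1%N) by [].
have [|p pE] := @factor_through_inj _ _ _ _ j (d 0%N) j_inj.
  by move=> x; exact/jde/dd0.
apply: (@injective_resolution_cons n N (I 0%N) D e p) => //.
  split=> //.
    apply/exactP; split=> [x|y py0]; first by apply: j_inj; rewrite pE linear0.
    by apply: ede; rewrite -pE py0 linear0.
  apply/surjP => y; have [x xE] := dde (j y) (dj0 y).
  by exists x; apply: j_inj; rewrite pE.
by apply: (IH D (fun j => I j.+1) (fun j => d j.+1) j c).
Qed.

Section Ext.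
Variables (I : nat -> lmodType A) (d : forall j, {linear I j -> I j.+1}).
Hypothesis injI : forall j, injective_module (I j).
Hypothesis exI : forall j, exact (d j) (d j.+1).

(** For an injective resolution [I] of [N] this is [Ext^(n+1) (X, N) = 0]:
    exactness of [Hom (X, I)] at [I n.+1]. *)
Definition ext_vanishes n X : Prop :=
  forall f : {linear X -> I n.+1}, (forall x, d n.+1 (f x) = 0) ->
  exists g : {linear X -> I n}, forall x, d n (g x) = f x.

Lemma ext_vanishes_retract n X Y (j : {linear X -> Y}) (r : {linear Y -> X}) :
  cancel j r -> ext_vanishes n Y -> ext_vanishes n X.
Proof.
move=> jK extY f df0; have [|g gE] := extY (f \o r : {linear Y -> I n.+1}).
  by move=> y; exact: df0.
by exists (g \o j : {linear X -> I n}) => x /=; rewrite gE /= jK.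
Qed.

Lemma ext_vanishes_projective n P : projective P -> ext_vanishes n P.
Proof.
move=> projP f df0; apply: projective_lift => // x.
by have /exactP[_] := exI n; apply.
Qed.

Lemma ext_vanishes_prod n X Y :
  ext_vanishes n X -> ext_vanishes n Y -> ext_vanishes n (X * Y)%type.
Proof.
move=> extX extY f df0.
have [iX iXE] := linear_pair (idfun : {linear X -> X}) (\0 : {linear X -> Y}).
have [iY iYE] := linear_pair (\0 : {linear Y -> X}) (idfun : {linear Y -> Y}).
have [|gX gXE] := extX (f \o iX : {linear X -> I n.+1}); first by move=> x; exact: df0.
have [|gY gYE] := extY (f \o iY : {linear Y -> I n.+1}); first by move=> x; exact: df0.
have [g gE] := linear_copair gX gY; exists g => -[x y].
by rewrite gE linearD gXE gYE /= -linearD iXE iYE /= pairD addr0 add0r.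
Qed.

(** A cocycle on [X] is pulled back to [P], where it is a coboundary; the
    restriction to [K] of a bounding map is a cocycle on [K]. In the other
    direction a cocycle on [K] is extended to [P] by injectivity, and its
    coboundary factors through [X]. *)
Lemma ext_vanishes_shift n K P X (i : {linear K -> P}) (p : {linear P -> X}) :
  projective P -> short_exact i p -> ext_vanishes n K <-> ext_vanishes n.+1 X.
Proof.
move=> projP [i_inj /exactP[pi0 ipe] pT].
have /exactP[ddn dde] := exI n; have /exactP[ddn1 _] := exI n.+1.
split=> ext f df0.
  have [|h hE] := @ext_vanishes_projective n.+1 P projP (f \o p : {linear P -> I n.+2}).
    by move=> x; exact: df0.
  have [|g gE] := ext (h \o i : {linear K -> I n.+1}).
    by move=> x; rewrite hE /= pi0 linear0.
  have [g' g'E] := @injI n K P i g i_inj.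
  have [|u uE] := factor_through_surj (f := h \- (d n \o g') : {linear P -> I n.+1}) pT.
    by move=> _ /ipe[x <-] /=; rewrite g'E gE subrr.
  exists u => x; have [y <-] := (surjP p).1 pT x.
  by rewrite uE /= linearB ddn subr0 hE.
have [h hE] := @injI n.+1 K P i f i_inj.
have [|u uE] := factor_through_surj (f := d n.+1 \o h : {linear P -> I n.+2}) pT.
  by move=> _ /ipe[x <-] /=; rewrite hE df0.
have [|v vE] := ext u.
  by move=> x; have [y <-] := (surjP p).1 pT x; rewrite uE ddn1.
have [|g gE] := @ext_vanishes_projective n P projP (h \- (v \o p) : {linear P -> I n.+1}).
  by move=> x; rewrite /= linearB vE uE /= subrr.
exists (g \o i : {linear K -> I n}) => x.
by rewrite /= gE /= hE pi0 linear0 subr0.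
Qed.

Lemma ext_vanishes_nsyzygy m n X K :
  is_nsyzygy m X K -> ext_vanishes n K <-> ext_vanishes (m + n) X.
Proof.
elim: m n K => [|m IH] n K.
  move=> /isomorphic_inverse[f [g [fK gK]]]; split; exact: ext_vanishes_retract.
case=> L [XL [P [p [i [[projP pT _] i_inj ipex]]]]].
rewrite addSnnS; have [IH1 IH2] := IH n.+1 _ XL.
have [|s1 s2] := @ext_vanishes_shift n K P L i p projP; first by split; first exact: i_inj.
by split=> [/s1/IH1|/IH2/s2].
Qed.

(** [Ext^(m+n+1) (X, N) = Ext^(n+1) (Omega^m X, N)] is a summand of
    [Ext^(n+1) (Omega^(m+1) M', N) = Ext^(m+n+2) (M', N)]. *)
Lemma ext_vanishes_deloop m n X : deloops_at X m ->
  (forall M, ext_vanishes (m + n).+1 M) -> ext_vanishes (m + n) X.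
Proof.
move=> [K [P [M' [L [XK [_ projP] _ ML [Z KZ]]]]]] extM.
apply/(ext_vanishes_nsyzygy _ XK).
have [f [g [fK gK]]] := isomorphic_inverse KZ.
have [iK iKE] := linear_pair (idfun : {linear K -> K}) (\0 : {linear K -> Z}).
apply: (@ext_vanishes_retract n _ _ (f \o iK : {linear K -> (P * L)%type})
  (fst \o g : {linear (P * L)%type -> K})).
  by move=> x /=; rewrite fK iKE.
apply: ext_vanishes_prod; first exact: ext_vanishes_projective.
by apply/(ext_vanishes_nsyzygy _ ML); exact: extM.
Qed.

End Ext.

End InjectiveResolutions.

(** * Suprema of dimensions *)

Section Dimensions.
Local Open Scope ereal_scope.

Lemma least_dimP (P : set nat) :
  (least_dim P = +oo /\ forall n, ~ P n) \/
  (exists n, [/\ P n, least_dim P = n%:Z%:E & forall m, P m -> (n <= m)%N]).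
Proof.
have [[n0 Pn0]|nP] := pselect (exists n, P n); last first.
  left; split; last by move=> n Pn; apply: nP; exists n.
  rewrite /least_dim; suff -> : [set n%:Z%:E | n in P] = set0 by rewrite /infimum eqxx.
  by apply/seteqP; split=> // x [n Pn _]; apply: nP; exists n.
right; have exP : exists n, `[< P n >] by exists n0; apply/asboolP.
have [n /asboolP Pn nmin] := ex_minnP exP.
have {}nmin m : P m -> (n <= m)%N by move=> Pm; apply: nmin; apply/asboolP.
exists n; split=> //; rewrite /least_dim /infimum ifF; last first.
  by apply/negP => /eqP e; have : set0 n%:Z%:E by rewrite -e; exists n.
apply: xget_subset1; last exact: is_subset1_infimums.
split; first by move=> _ [m Pm <-]; rewrite lee_fin lez_nat; exact: nmin.
by move=> x; apply; exists n.
Qed.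

Lemma least_dim_le (P : set nat) n : P n -> least_dim P <= n%:Z%:E.
Proof.
move=> Pn; have [[_ /(_ n Pn)//]|[m [_ -> mmin]]] := least_dimP P.
by rewrite lee_fin lez_nat; exact: mmin.
Qed.

Lemma least_dim_ge0 (P : set nat) : 0 <= least_dim P.
Proof. by have [[-> _]|[n [_ -> _]]] := least_dimP P. Qed.

Lemma least_dim_ltP (P : set nat) (x : \bar int) : least_dim P < x ->
  exists n, P n /\ least_dim P = n%:Z%:E.
Proof.
have [[-> _]|[n [Pn -> _] _]] := least_dimP P; first by case: x.
by exists n.
Qed.

(** Nonnegative elements of [\bar int] are natural numbers or infinity, so the
    least natural upper bound, or infinity when there is none, is a supremum. *)
Lemma sup_dim_supremums (X : set (\bar int)) : X !=set0 -> (forall x, X x -> 0 <= x) ->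
  supremums X (sup_dim X).
Proof.
move=> X0 Xge0; rewrite /sup_dim /supremum ifF; last by apply/negP/negP/set0P.
apply: xgetPex; have [[n0 ubn0]|nub] := pselect (exists n, ubound X n%:Z%:E).
  have exP : exists n, `[< ubound X n%:Z%:E >] by exists n0; apply/asboolP.
  have [n /asboolP ubn nmin] := ex_minnP exP.
  exists n%:Z%:E; split=> // y uby; have [x Xx] := X0.
  have := le_trans (Xge0 x Xx) (uby x Xx).
  case: y uby => [[m|m]||] // ubm _; rewrite ?leey //.
  by rewrite lee_fin lez_nat; apply: nmin; apply/asboolP.
exists +oo; split=> [x _|y uby]; first exact: leey.
have [x Xx] := X0; have := le_trans (Xge0 x Xx) (uby x Xx).
by case: y uby => [[m|m]||] // ubm _; case: nub; exists m.
Qed.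

Lemma sup_dim_ge (X : set (\bar int)) x : (forall x, X x -> 0 <= x) -> X x -> x <= sup_dim X.
Proof. by move=> Xge0 Xx; have [+ _] := sup_dim_supremums (ex_intro _ x Xx) Xge0; apply. Qed.

Lemma sup_dim_le (X : set (\bar int)) y :
  (forall x, X x -> 0 <= x) -> (forall x, X x -> x <= y) -> sup_dim X <= y.
Proof.
move=> Xge0 Xy; have [->|/set0P X0] := eqVneq X set0; first by rewrite /sup_dim supremum0 leNye.
by have [_ +] := sup_dim_supremums X0 Xge0; apply.
Qed.

End Dimensions.

(** * Injectivity is tested on simple modules *)

Section Injectivity.
Variables (k : comNzRingType) (A : algType k).
Hypothesis hA : artin_algebra A.
Implicit Types C D E I J K L M N P Q S U V W X Y Z : lmodType A.

(** A Baer argument. A maximal extension [N] of [f], viewed as a graph in [V * C],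
    has a domain [D]. If [D] is not all of [V], some simple [S] embeds in
    [V / D]. Extend the map from [D] to [F : V -> I]; the obstruction to landing
    in [C] is [d F], which factors through [V / D] and whose restriction to [S]
    lifts to [I] by hypothesis. Subtracting an extension [w'] of that lift
    gives [G], which has values in [C] on the preimage of [S] and still agrees
    with the old map on [D], contradicting maximality. *)
Lemma injective_of_simple_lifts C I J (i : {linear C -> I}) (d : {linear I -> J}) :
  injective i -> exact i d -> injective_module I ->
  (forall S (f : {linear S -> J}), simple_module S ->
     exists g : {linear S -> I}, forall x, d (g x) = f x) ->
  injective_module C.
Proof.
move=> i_inj /exactP[di0 ide] injI liftS U V g f g_inj.
have [b bE] := linear_pair g f.
pose E : set (V * C) := [set u | u.1 = 0 /\ u.2 <> 0].
have [||N [hN bN NE Nmax]] := @maximal_submodule_avoiding _ (V * C)%type (range b) E.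
- exact: range_submodule.
- move=> _ [u _ <-]; rewrite bE => -[/= gu0 fu0]; apply: fu0.
  by rewrite (g_inj u 0) ?linear0.
have [R [r [r_inj rN]]] := submodule_as_module hN.
pose r1 := fst \o r : {linear R -> V}; pose r2 := snd \o r : {linear R -> C}.
have r1_inj : injective r1.
  apply: injectiveP0 => x r1x0; apply: r_inj; rewrite linear0.
  have : ~ E (r x) by apply: NE; rewrite -rN; exists x.
  move: r1x0; rewrite /r1 /E /=; case: (r x) => a c /= -> nc.
  by congr (_, _); apply: contrapT => c0; apply: nc.
have [r1T|r1T] := pselect (range r1 = [set: V]).
  have [|s sE] := @factor_through_inj _ V V R r1 idfun r1_inj.
    by move=> v; exact: (surjP r1).1 r1T v.
  exists (r2 \o s : {linear V -> C}) => u.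
  have : range r (g u, f u) by rewrite rN; apply: bN; exists u.
  case=> x _ rx; have sg : s (g u) = x by apply: r1_inj; rewrite sE /= /r1 /= rx.
  by rewrite /= sg /r2 /= rx.
have [Q [p [/surjP pT pE]]] := quotient_module (range_submodule r1).
have pr1 x : p (r1 x) = 0 by have : kernel p (r1 x) by rewrite pE; exists x.
have [q q0] : exists q : Q, q != 0.
  apply: contrapT => Q0; apply: r1T; apply/seteqP; split=> // v _.
  rewrite -pE /kernel /=; apply: contrapT => /eqP pv0; apply: Q0.
  by exists (p v).
have [S [j [simS j_inj]]] := exists_simple_submodule hA q0.
have [F FE] := injI R V r1 (i \o r2 : {linear R -> I}) r1_inj.
have dF0 v : p v = 0 -> d (F v) = 0.
  move=> pv0; have : kernel p v by [].
  by rewrite pE => -[x _ <-]; rewrite FE di0.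
have [|t tE] := factor_through_surj (f := d \o F : {linear V -> J}) ((surjP p).2 pT).
  exact: dF0.
have [w wE] := liftS S (t \o j : {linear S -> J}) simS.
have [w' w'E] := injI S Q j w j_inj.
pose G := F \- (w' \o p) : {linear V -> I}.
have GE x : G (r1 x) = i (r2 x) by rewrite /G /= pr1 linear0 subr0 FE.
have dG v : range j (p v) -> d (G v) = 0.
  by case=> x _ jx; rewrite /G /= linearB -[d (F v)]/((d \o F) v) -tE -jx w'E wE subrr.
pose N' : set (V * C) := [set u | range j (p u.1) /\ i u.2 = G u.1].
have hN' : is_submodule N'.
  split; first by split; [exists 0; rewrite // !linear0 | rewrite (linear0 i) (linear0 G)].
  move=> a [v c] [v' c'] [jv ic] [jv' ic']; split; last first.
    by rewrite (linearP i a c c') (linearP G a v v') ic ic'.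
  rewrite (linearP p a v v'); have [_ jS] := range_submodule j.
  exact: jS.
have NN' : N `<=` N'.
  rewrite -rN => _ [x _ <-]; split; last exact/esym/GE.
  by exists 0; rewrite // linear0 -[(r x).1]/(r1 x) pr1.
have N'N : N' `<=` N.
  apply: Nmax => // -[v c] [_ /= ic] [/= v0 c0]; apply: c0.
  by apply: i_inj; rewrite ic v0 !linear0 addr0.
have [[x x0] _] := simS; have [v vE] := pT (j x).
have [|c cE] := ide (G v); first by apply: dG; rewrite vE; exists x.
have : N (v, c) by apply: N'N; split=> //=; rewrite vE; exists x.
rewrite -rN => -[y _ ry]; have vr : v = r1 y by rewrite /r1 /= ry.
case/eqP: x0; apply: j_inj.
by rewrite linear0 -vE vr pr1.
Qed.

(** All terms beyond [n.+1] vanish, so [Ext^(n+2)] is zero and simple modules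
    that deloop at [m <= n] have no [Ext^(n+1)] into [N]. *)
Lemma injective_resolution_shorten N n :
  (forall S, simple_module S -> exists2 m, (m <= n)%N & deloops_at S m) ->
  has_injective_resolution N n.+1 -> has_injective_resolution N n.
Proof.
move=> delS [I [d [e [injI I0 e_inj ede exI]]]].
have [C [c [c_inj cE]]] := submodule_as_module (kernel_submodule (d n)).
have cex : exact c (d n) by [].
apply: (injective_resolution_truncate (d := d) (e := e) (c := c)) => //.
apply: injective_of_simple_lifts c_inj cex (injI n) _ => S f simS.
have [m mn delm] := delS S simS.
have : ext_vanishes d (m + (n - m)) S.
  apply: ext_vanishes_deloop delm _ => // M g _.
  exists \0 => x; rewrite linear0 [RHS]I0 //.
  by rewrite subnKC.
rewrite subnKC // => extS; apply: extS => x.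
by rewrite [LHS]I0.
Qed.

Lemma exists_simple_module : exists S : lmodType A, simple_module S.
Proof.
have [S [_ [simS _]]] := exists_simple_submodule hA (oner_neq0 A : (1 : A^o) != 0).
by exists S.
Qed.

End Injectivity.

(** * The chain of inequalities *)

Theorem theorem2p4 (k : comNzRingType) (A : algType k) (hA : artin_algebra A)
    (M : lmodType A -> lmodType A)
    (hM : forall S : lmodType A, simple_module S ->
       [/\ embeds_in S (M S), finitely_generated (M S) & (pd (M S) < +oo)%E])
    (d : \bar int) (hd : d = max_simple (fun S : lmodType A => pd (M S))) :
  [/\ (Fin_inj A <= del_ring A)%E, (del_ring A <= d)%E & (d <= fin_pro A)%E].
Proof.
have del_ge0 x : [set x | exists S : lmodType A, simple_module S /\ x = del S] x ->
    (0 <= x)%E by case=> S [_ ->]; exact: least_dim_ge0.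
have pdM_ge0 x : [set x | exists S : lmodType A, simple_module S /\ x = pd (M S)] x ->
    (0 <= x)%E by case=> S [_ ->]; exact: least_dim_ge0.
split.
- apply: sup_dim_le => [_ [N [_ ->]]|_ [N [idN ->]]]; first exact: least_dim_ge0.
  rewrite leNgt; apply/negP; have [n [resN idNn]] := least_dim_ltP idN.
  have delE (S : lmodType A) : simple_module S -> (del S <= del_ring A)%E.
    by move=> simS; apply: sup_dim_ge => //; exists S.
  rewrite [id_dim N]idNn; case: n resN idNn => [|n] resN idNn del_lt.
    have [S simS] := exists_simple_module hA.
    have := le_lt_trans (delE S simS) del_lt.
    by apply/negP; rewrite -leNgt; exact: least_dim_ge0.
  have /least_dim_le : has_injective_resolution N n.
    apply: (injective_resolution_shorten hA) resN => S simS.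
    have delS := le_lt_trans (delE S simS) del_lt.
    have [m [delm mE]] := least_dim_ltP delS; exists m => //.
    by move: delS; rewrite -[del S]/(least_dim _) mE lte_fin ltz_nat ltnS.
  by rewrite idNn lee_fin lez_nat ltnn.
- apply: sup_dim_le => // _ [S [simS ->]]; have [SM fgM pdM] := hM S simS.
  have [n [resM pdE]] := least_dim_ltP pdM.
  have : (pd (M S) <= d)%E by rewrite hd; apply: sup_dim_ge => //; exists S.
  apply: le_trans; rewrite /pd pdE; apply: least_dim_le.
  exact: deloops_at_of_embedding SM fgM resM.
- rewrite hd; apply: sup_dim_le => // _ [S [simS ->]]; have [SM fgM pdM] := hM S simS.
  apply: sup_dim_ge; last by exists (M S).
  by move=> _ [? [_ _ ->]]; exact: least_dim_ge0.
Qed.
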